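(* Let $k$ be a field, let $d$ be a positive integer, and let $R$ be the nonreduced $d$-dimensional local ring $R=k[[x_1,\ldots,x_d,y]]/(y^2)$. There exists a graded family of $m_R$-primary ideals $\{I_n\}$ in $R$ such that the limit $$\lim_{n\rightarrow \infty} \frac{\ell(R/I_n)}{n^d}$$ does not exist, even when $n$ is constrained to lie in any arithmetic sequence; that is, for all $a\in\mathbb N$ and all positive integers $r$, the limit of $\ell(R/I_n)/n^d$ as $n\to\infty$ with $n\in\{a+br\mid b\in\mathbb N\}$ does not exist.
   Context: $m_R$ denotes the maximal ideal of the local ring $R$, and $\ell$ denotes the length of an $R$-module. A graded family of ideals in $R$ is a family of ideals $\{I_n\}_{n\ge 0}$ in $R$ such that $I_0=R$ and $I_mI_n\subset I_{m+n}$ for all $m,n$. It is a graded family of $m_R$-primary ideals if moreover $I_n$ is $m_R$-primary for all $n\ge 1$. *)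

(* Defs.v *)
From HB Require Import structures.
From mathcomp Require Import all_boot all_order all_algebra.
(* The notations of mpoly.v clash with those of mathcomp-analysis: mpoly.v is
   only imported inside the module FPS, before the analysis library. *)
From mathcomp Require mpoly boolp.

Set Implicit Arguments.
Unset Strict Implicit.
Unset Printing Implicit Defensive.

Import GRing.Theory.
Local Open Scope ring_scope.

Module FPS.
Import mpoly.

(* k[[X_0, ..., X_(n-1)]]: a formal power series is an arbitrary family of
   coefficients indexed by the exponents. *)
Record fps (n : nat) (k : Type) : Type := Fps { fps_coef :> 'X_{1..n} -> k }.

Lemma fpsP (n : nat) (k : Type) (p q : fps n k) : p =1 q -> p = q.
Proof. by case: p q => [p] [q] /= /boolp.funext ->. Qed.

HB.instance Definition _ n k := boolp.gen_eqMixin (fps n k).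
HB.instance Definition _ n k := boolp.gen_choiceMixin (fps n k).

Section Ring.
Context (n : nat) (k : comNzRingType).
Implicit Types p q r : fps n k.

Definition fps_const (c : k) : fps n k := Fps (fun m => c *+ (m == 0%MM)).
Definition fps_var (i : 'I_n) : fps n k := Fps (fun m => (m == U_(i)%MM)%:R).
Definition fps_add p q : fps n k := Fps (fun m => p m + q m).
Definition fps_opp p : fps n k := Fps (fun m => - p m).

(* Cauchy product; the bound on the degrees of h.1 and h.2 only serves to make
   the index type finite, and follows from m = h.1 + h.2. *)
Definition fps_mul p q : fps n k := Fps (fun m =>
  \sum_(h : 'X_{1..n < (mdeg m).+1, (mdeg m).+1} | m == (h.1 + h.2)%MM)
    p h.1 * q h.2).

Lemma fps_addA : associative fps_add.
Proof. by move=> p q r; apply: fpsP => m /=; rewrite addrA. Qed.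
Lemma fps_addC : commutative fps_add.
Proof. by move=> p q; apply: fpsP => m /=; rewrite addrC. Qed.
Lemma fps_add0 : left_id (fps_const 0) fps_add.
Proof. by move=> p; apply: fpsP => m /=; rewrite mul0rn add0r. Qed.
Lemma fps_addN : left_inverse (fps_const 0) fps_opp fps_add.
Proof. by move=> p; apply: fpsP => m /=; rewrite mul0rn addNr. Qed.

HB.instance Definition _ :=
  GRing.isZmodule.Build (fps n k) fps_addA fps_addC fps_add0 fps_addN.

(* The ring axioms are transported from {mpoly k[n]} by truncation. *)
Definition fps_trunc (N : nat) p : {mpoly k[n]} :=
  \sum_(m : 'X_{1..n < N}) p m *: 'X_[m].

Lemma fps_truncE N p m : (fps_trunc N p)@_m = if (mdeg m < N)%N then p m else 0.
Proof.
rewrite raddf_sum /=; case: ltnP => [lt_mN | le_Nm].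
  rewrite (bigD1 (BMultinom lt_mN)) //= mcoeffZ mcoeffX eqxx mulr1.
  rewrite big1 ?addr0 // => i ne_im.
  by move: ne_im; rewrite mcoeffZ mcoeffX bmeqP /= => /negPf ->; rewrite mulr0.
rewrite big1 // => i _; rewrite mcoeffZ mcoeffX.
have [eim|_] := eqVneq (i : 'X_{1..n}) m; last by rewrite mulr0.
by move: (bmdeg i); rewrite eim ltnNge le_Nm.
Qed.

Lemma fps_mulE p q m (P Q : {mpoly k[n]}) :
  (forall m', (mdeg m' <= mdeg m)%N -> P@_m' = p m') ->
  (forall m', (mdeg m' <= mdeg m)%N -> Q@_m' = q m') ->
  fps_mul p q m = (P * Q)@_m.
Proof.
move=> eP eQ; rewrite mcoeffM /=; apply: eq_bigr => h _.
by rewrite eP ?eQ // -ltnS bmdeg.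
Qed.

Lemma fps_mul_trunc p q m N : (mdeg m < N)%N ->
  fps_mul p q m = (fps_trunc N p * fps_trunc N q)@_m.
Proof.
move=> lt_mN; apply: fps_mulE => m' le_m'm;
by rewrite fps_truncE (leq_ltn_trans le_m'm lt_mN).
Qed.

Lemma fps_mulA : associative fps_mul.
Proof.
move=> p q r; apply: fpsP => m; set N := (mdeg m).+1.
rewrite (@fps_mulE _ _ _ (fps_trunc N p) (fps_trunc N q * fps_trunc N r)).
- rewrite (@fps_mulE _ _ _ (fps_trunc N p * fps_trunc N q) (fps_trunc N r)).
  + by rewrite mulrA.
  + by move=> m' lm; rewrite (@fps_mul_trunc _ _ _ N).
  + by move=> m' lm; rewrite fps_truncE ltnS lm.
- by move=> m' lm; rewrite fps_truncE ltnS lm.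
- by move=> m' lm; rewrite (@fps_mul_trunc _ _ _ N).
Qed.

Lemma fps_mulC : commutative fps_mul.
Proof.
by move=> p q; apply: fpsP => m; rewrite !(@fps_mul_trunc _ _ m _ (leqnn _)) mulrC.
Qed.

Lemma fps_mul1 : left_id (fps_const 1) fps_mul.
Proof.
move=> p; apply: fpsP => m.
rewrite (@fps_mulE _ _ _ 1 (fps_trunc (mdeg m).+1 p)).
- by rewrite mul1r fps_truncE ltnS leqnn.
- by move=> m' _; rewrite mcoeff1.
- by move=> m' lm; rewrite fps_truncE ltnS lm.
Qed.

Lemma fps_mulD : left_distributive fps_mul fps_add.
Proof.
move=> p q r; apply: fpsP => m /=; rewrite -big_split.
by apply: eq_bigr => h _; rewrite /= mulrDl.
Qed.

Lemma fps_one_neq0 : fps_const 1 != 0.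
Proof.
apply/eqP => /(congr1 (fun p => fps_coef p 0%MM)) /=.
by rewrite eqxx mul0rn mulr1n => /eqP; rewrite oner_eq0.
Qed.

HB.instance Definition _ := GRing.Zmodule_isComNzRing.Build (fps n k)
  fps_mulA fps_mulC fps_mul1 fps_mulD fps_one_neq0.

Lemma fps_coefD p q m : (p + q) m = p m + q m. Proof. by []. Qed.
Lemma fps_coefN p m : (- p) m = - p m. Proof. by []. Qed.
Lemma fps_coef0 m : (0 : fps n k) m = 0. Proof. exact: mul0rn. Qed.
Lemma fps_coef1 m : (1 : fps n k) m = (m == 0%MM)%:R. Proof. by []. Qed.
Lemma fps_var0 i : fps_var i 0%MM = 0.
Proof. by rewrite /= eq_sym mnm1_eq0. Qed.
Lemma fps_coef_sum (T : Type) (s : seq T) (F : T -> fps n k) m :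
  (\sum_(i <- s) F i) m = \sum_(i <- s) F i m.
Proof. by apply: (big_morph (fun p : fps n k => p m)) => //; apply: fps_coef0. Qed.

Lemma fps_coefM p q m : (p * q) m =
  \sum_(h : 'X_{1..n < (mdeg m).+1, (mdeg m).+1} | m == (h.1 + h.2)%MM)
    p h.1 * q h.2.
Proof. by []. Qed.

Lemma fps_coefM0 p q : (p * q) 0%MM = p 0%MM * q 0%MM.
Proof.
rewrite (@fps_mulE _ _ _ (fps_trunc 1 p) (fps_trunc 1 q)).
- by rewrite rmorphM /= !fps_truncE mdeg0.
- by move=> m'; rewrite mdeg0 leqn0 => /eqP e; rewrite fps_truncE e.
- by move=> m'; rewrite mdeg0 leqn0 => /eqP e; rewrite fps_truncE e.
Qed.

Lemma fps_eq_coefM p q q' m :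
  (forall m', (mdeg m' <= mdeg m)%N -> q m' = q' m') -> (p * q) m = (p * q') m.
Proof.
by move=> eq; rewrite !fps_coefM; apply: eq_bigr => h _; rewrite eq // -ltnS bmdeg.
Qed.

Lemma fps_coefX p i m : p 0%MM = 0 -> (mdeg m < i)%N -> (p ^+ i) m = 0.
Proof.
move=> p0; elim: i m => [//|i IH] m lt_mi; rewrite exprS fps_coefM.
apply: big1 => h /eqP em; have [->|nz] := eqVneq (h.1 : 'X_{1..n}) 0%MM.
  by rewrite p0 mul0r.
have dm : (mdeg m = mdeg h.1 + mdeg h.2)%N by rewrite -mdegD -em.
rewrite IH ?mulr0 //; have := leq_ltn_trans (eq_leq (esym dm)) lt_mi; rewrite ltnS.
by apply: leq_trans; rewrite -add1n leq_add2r lt0n mdeg_eq0.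
Qed.

End Ring.

Lemma fps_unitP n (k : fieldType) (p : fps n k) :
  reflect (exists q, p * q = 1) (p 0%MM != 0).
Proof.
apply: (iffP idP) => [p0|[q pq1]]; last first.
  apply/eqP => p0; have := congr1 (fun r => fps_coef r 0%MM) pq1.
  by rewrite fps_coefM0 p0 mul0r fps_coef1 eqxx => /esym/eqP; rewrite oner_eq0.
pose g := 1 - p * fps_const n (p 0%MM)^-1.
have g0 : g 0%MM = 0.
  by rewrite fps_coefD fps_coefN fps_coefM0 /= eqxx !mulr1n divff ?subrr.
pose G : fps n k := Fps (fun m => \sum_(i < (mdeg m).+1) (g ^+ i) m).
exists (fps_const n (p 0%MM)^-1 * G); rewrite mulrA.
have -> : p * fps_const n (p 0%MM)^-1 = 1 - g by rewrite opprB addrC subrK.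
apply: fpsP => m; set N := (mdeg m).+1.
rewrite (@fps_eq_coefM _ _ _ _ (\sum_(i < N) g ^+ i)).
  by rewrite -[1 - g]opprB mulNr -subrX1 opprB fps_coefD fps_coefN fps_coefX ?subr0.
move=> m' lm; rewrite fps_coef_sum /=.
rewrite (big_ord_widen N (fun i => (g ^+ i) m')) ?ltnS // big_mkcond /=.
by apply: eq_bigr => i _; case: ltnP => // lt; rewrite fps_coefX.
Qed.

End FPS.

From mathcomp Require Import boolp classical_sets reals ereal.
From mathcomp Require Import topology normedtype sequences.
Export FPS.

Local Open Scope quotient_scope.

(* An ideal of A (possibly A itself) is a submodule of the regular module A^o;
   ring_quotient's idealr only covers proper ideals. *)
Definition ideal (A : comNzRingType) := submodClosed A^o.

Section QuotientModule.
Context (A : comNzRingType) (M : lmodType A) (N : submodClosed M).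

Lemma submod_subr_closed : GRing.subr_closed (N : {pred M}).
Proof. by move=> x y Nx Ny; rewrite -scaleN1r rpredD ?rpredZ. Qed.

Definition submod_zmod : zmodClosed M :=
  HB.pack (GRing.SubmodClosed.sort N)
    (GRing.isZmodClosed.Build M _ (conj (rpred0 N) submod_subr_closed)).

Definition quot_module := Quotient.quot submod_zmod.
HB.instance Definition _ := GRing.Zmodule.on quot_module.
HB.instance Definition _ := EqQuotient.on quot_module.

Implicit Types (a b : A) (x y : quot_module).

Lemma pi_quot_moduleE (u v : M) :
  (\pi_quot_module u == \pi_quot_module v) = (u - v \in N).
Proof. exact: esym (@Quotient.idealrBE M submod_zmod u v). Qed.

Lemma pi_quot_moduleD : {morph \pi_quot_module : u v / u + v}.
Proof. exact: raddfD. Qed.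

Definition quot_scale a x : quot_module := \pi_quot_module (a *: repr x).

Lemma pi_quot_scale a (u : M) : \pi_quot_module (a *: u) = quot_scale a (\pi_quot_module u).
Proof.
apply/eqP; rewrite pi_quot_moduleE -scalerBr rpredZ // -pi_quot_moduleE.
by rewrite reprK.
Qed.

Lemma quot_scaleA a b x : quot_scale a (quot_scale b x) = quot_scale (a * b) x.
Proof. by rewrite -[x]reprK -(pi_quot_scale b) -!pi_quot_scale scalerA. Qed.
Lemma quot_scale1 : left_id 1 quot_scale.
Proof. by move=> x; rewrite -[x]reprK -!pi_quot_scale scale1r. Qed.
Lemma quot_scaleDr : right_distributive quot_scale +%R.
Proof.
move=> a x y; rewrite -[x]reprK -[y]reprK.
by rewrite -pi_quot_moduleD -!pi_quot_scale scalerDr pi_quot_moduleD.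
Qed.
Lemma quot_scaleDl x : {morph quot_scale^~ x : a b / a + b}.
Proof. by move=> a b; rewrite -[x]reprK -!pi_quot_scale scalerDl pi_quot_moduleD. Qed.

HB.instance Definition _ := GRing.Zmodule_isLmodule.Build A quot_module
  quot_scaleA quot_scale1 quot_scaleDr quot_scaleDl.

End QuotientModule.

(* c 0 < c 1 < ... < c n is a strictly increasing chain of submodules of M. *)
Definition submod_chain (A : comNzRingType) (M : lmodType A) (n : nat)
    (c : nat -> {pred M}) : Prop :=
  (forall i, (i <= n)%N -> GRing.submod_closed (c i)) /\
  (forall i, (i < n)%N ->
     {subset c i <= c i.+1} /\ ~ {subset c i.+1 <= c i}).

Definition module_length (R : realType) (A : comNzRingType) (M : lmodType A)
    : \bar R :=
  ereal_sup [set n%:R%:E | n in [set n | exists c, submod_chain (M := M) n c]].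

Section Ideals.
Context (A : comNzRingType).
Implicit Types I J : {pred A}.

Definition principal_ideal (a : A) : {pred A} :=
  [pred x | `[< exists b, x = a * b >]].

Definition ideal_mul I J : {pred A} :=
  [pred x | `[< exists s : seq (A * A),
      (forall p, p \in s -> p.1 \in I /\ p.2 \in J) /\
      x = \sum_(p <- s) p.1 * p.2 >]].

Definition radical I : {pred A} := [pred x | `[< exists n, x ^+ n \in I >]].

Definition primary I : Prop :=
  1 \notin I /\
  forall x y, x * y \in I -> x \in I \/ exists n, y ^+ n \in I.

(* The maximal ideal of a local ring is its set of nonunits. *)
Definition max_ideal : {pred A} := [pred x | `[< ~ exists y, x * y = 1 >]].

Definition max_primary (I : ideal A) : Prop :=
  primary (I : {pred A}) /\ radical (I : {pred A}) =i max_ideal.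

Definition graded_family (I : nat -> ideal A) : Prop :=
  I 0%N =i predT /\
  forall m n, {subset ideal_mul (I m) (I n) <= I (m + n)%N}.

(* A is local iff its nonunits form an ideal. *)
Definition local_ring : Prop := GRing.submod_closed (max_ideal : {pred A^o}).

End Ideals.

Arguments module_length R {A} M.
Arguments max_ideal : clear implicits.
Arguments local_ring : clear implicits.

Section NilRing.
Context (k : fieldType) (d : nat).

(* In k[[x_1, ..., x_d, y]] the variables x_1, ..., x_d have index < d, and y is
   the last one. *)
Definition ideal_y2 : {pred fps d.+1 k} :=
  principal_ideal (fps_var k ord_max ^+ 2).

Lemma ideal_y2_closed : idealr_closed ideal_y2.
Proof.
split.
- by apply/asboolP; exists 0; rewrite mulr0.
- apply/asboolP => -[b] /(congr1 (fun p => fps_coef p mpoly.mnm0)).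
  rewrite fps_coefM0 expr2 fps_coefM0 fps_var0 !mul0r fps_coef1 eqxx.
  by move/eqP; rewrite oner_eq0.
- move=> a u v /asboolP[b ->] /asboolP[c ->]; apply/asboolP.
  by exists (a * b + c); rewrite mulrDr mulrCA.
Qed.

HB.instance Definition _ := isIdealr.Build (fps d.+1 k) ideal_y2 ideal_y2_closed.

Definition nil_ring : Type := {ideal_quot ideal_y2}.
HB.instance Definition _ := GRing.ComNzRing.on nil_ring.
HB.instance Definition _ := EqQuotient.on nil_ring.

Lemma pi_nil_ringE (p q : fps d.+1 k) :
  (\pi_nil_ring p == \pi_nil_ring q) = (p - q \in ideal_y2).
Proof. exact: esym (Quotient.idealrBE _ p q). Qed.

Lemma pi_nil_ringM : {morph \pi_nil_ring : p q / p * q}.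
Proof. exact: rmorphM. Qed.

Lemma pi_nil_ringD : {morph \pi_nil_ring : p q / p + q}.
Proof. exact: raddfD. Qed.

Lemma pi_nil_ring1 : \pi_nil_ring 1 = 1.
Proof. exact: rmorph1. Qed.

Lemma ideal_y2_coef0 p : p \in ideal_y2 -> p mpoly.mnm0 = 0.
Proof.
by move=> /asboolP[b ->]; rewrite fps_coefM0 expr2 fps_coefM0 fps_var0 !mul0r.
Qed.

Lemma nil_ring_nonunitE (p : fps d.+1 k) :
  (\pi_nil_ring p \in max_ideal nil_ring) = (p mpoly.mnm0 == 0).
Proof.
apply/asboolP/idP => [nonunit | /eqP p0 [q]].
  apply/negPn/negP => /fps_unitP[q pq1]; apply: nonunit; exists (\pi q).
  by rewrite -pi_nil_ringM pq1 pi_nil_ring1.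
rewrite -[q]reprK -pi_nil_ringM -pi_nil_ring1 => /eqP.
rewrite pi_nil_ringE => /ideal_y2_coef0/eqP.
by rewrite fps_coefD fps_coefN fps_coefM0 p0 mul0r add0r fps_coef1 eqxx oppr_eq0 oner_eq0.
Qed.

Lemma nil_ring_local : local_ring nil_ring.
Proof.
split=> [|a x y].
  have -> : (0 : nil_ring^o) = \pi_nil_ring 0 by rewrite raddf0.
  by rewrite nil_ring_nonunitE fps_coef0.
rewrite -[a]reprK -[x]reprK -[y]reprK !nil_ring_nonunitE => /eqP x0 /eqP y0.
rewrite -[_ *: _]/(_ * _ : nil_ring) -pi_nil_ringM -[_ + _]/(_ + _ : nil_ring).
by rewrite -pi_nil_ringD nil_ring_nonunitE fps_coefD fps_coefM0 x0 y0 mulr0 addr0.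
Qed.

Lemma nil_ring_nonreduced : exists2 x : nil_ring, x != 0 & x ^+ 2 = 0.
Proof.
have e0 : 0 = \pi_nil_ring 0 by rewrite raddf0.
pose y : fps d.+1 k := fps_var k ord_max; exists (\pi_nil_ring y).
  rewrite e0 pi_nil_ringE subr0; apply/asboolP => -[b].
  move=> /(congr1 (fun p => fps_coef p (mpoly.mnm1 ord_max))).
  rewrite mulrC (@fps_eq_coefM _ _ b _ 0); last first.
    move=> m lm; rewrite fps_coefX ?fps_coef0 ?fps_var0 //.
    by rewrite (leq_ltn_trans lm) // mpoly.mdeg1.
  by rewrite mulr0 fps_coef0 /= eqxx => /eqP; rewrite oner_eq0.
rewrite expr2 -pi_nil_ringM e0; apply/eqP; rewrite pi_nil_ringE subr0.
by apply/asboolP; exists 1; rewrite mulr1 expr2.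
Qed.

End NilRing.

(* Main.v *)
Require Import Defs.
From HB Require Import structures.
From mathcomp Require Import all_boot all_order all_algebra.
From mathcomp Require mpoly boolp.
From mathcomp Require Import zify.

(* Write R = S + S y with S = k[[x_1, ..., x_d]] and m = (x_1, ..., x_d).  For a
   nondecreasing s, the ideals I_n = m^n + m^(n - s n) y form a graded family:
   the inclusion m^a * m^(b - s b) y in m^(a + b - s (a + b)) y only requires
   s b <= s (a + b).  The monomials of degree < n in the x_i, and y times those of
   degree < n - s n, are a basis of R / I_n over k, and listed by decreasing degree
   they yield a composition series, so R / I_n has length
   C(n+d-1, d) + C(n - s n + d-1, d).  The first term over n^d tends to 1/d!.  Take
   for s n the largest power of 2 up to n.  Every arithmetic progression of step r
   meets [2^j, 2^j + r), where the second term is bounded, as well as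
   [2^(j+1) - r, 2^(j+1)), where the second term over n^d stays above 1/(4^d d!). *)

Set Implicit Arguments.
Unset Strict Implicit.
Unset Printing Implicit Defensive.

Import GRing.Theory.
Local Open Scope ring_scope.

(** * Combinatorics of the standard monomials *)

Module StandardMonomials.
Import mpoly.
Local Open Scope nat_scope.

Definition simplex (d n : nat) : seq 'X_{1..d} :=
  [seq bmnm m | m <- enum {: 'X_{1..d < n}}].

Lemma mem_simplex d n (m : 'X_{1..d}) : (m \in simplex d n) = (mdeg m < n).
Proof.
apply/mapP/idP => [[b _ ->] | lt_mn]; first exact: bmdeg.
by exists (BMultinom lt_mn); rewrite // mem_enum.
Qed.

Lemma uniq_simplex d n : uniq (simplex d n).
Proof. by rewrite map_inj_uniq ?enum_uniq //; apply: val_inj. Qed.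

(** An exponent of degree less than [n.+1] is a [d]-tuple over ['I_n.+1] of sum at most [n], and
    [card_partial_ord_partitions] counts these. For [n = 0] the coefficient is ['C(d.-1, d)], which
    vanishes because [d > 0]. *)
Lemma size_simplex d n : 0 < d -> size (simplex d n) = 'C((n + d).-1, d).
Proof.
move=> d_gt0; rewrite size_map -cardE; case: n => [|n].
  rewrite bin_small; last by rewrite add0n prednK.
  by apply: eq_card0 => m; have := bmdeg m.
rewrite addSn /= addnC -card_partial_ord_partitions.
pose f (m : 'X_{1..d < n.+1}) : d.-tuple 'I_n.+1 := [tuple inord (m i) | i < d].
have fE m i : tnth (f m) i = m i :> nat.
  rewrite tnth_mktuple inordK // (leq_ltn_trans _ (bmdeg m)) // mdegE.
  by rewrite (bigD1 i) //= leq_addr.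
have f_inj : injective f.
  move=> m m' eq_f; apply/val_inj/mnmP => i.
  by rewrite -!fE eq_f.
rewrite -(card_imset _ f_inj); apply: eq_card => t; rewrite !inE.
rewrite (big_tuple _ _ t xpredT (fun i : 'I_n.+1 => nat_of_ord i)) /=.
apply/imsetP/idP => [[m _ ->] | le_tn].
  by rewrite (eq_bigr _ (fun i _ => fE m i)) -mdegE -ltnS bmdeg.
have lt_tn : mdeg [multinom (tnth t i : nat) | i < d] < n.+1.
  by rewrite mdegE ltnS (eq_bigr _ (fun i _ => mnmE _ i)).
exists (BMultinom lt_tn) => //; apply: eq_from_tnth => i; apply: val_inj.
by rewrite /= fE mnmE.
Qed.

Section Standard.
Context (d : nat).
Implicit Types m : 'X_{1..d.+1}.

Lemma ord_max_le_mdeg m : m ord_max <= mdeg m.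
Proof. by rewrite mdegE (bigD1 ord_max) //= leq_addr. Qed.

Definition append_exponent (b : nat) (m : 'X_{1..d}) : 'X_{1..d.+1} :=
  [multinom (if unlift ord_max i is Some j then m j else b) | i < d.+1].

Definition drop_exponent m : 'X_{1..d} := [multinom m (lift ord_max i) | i < d].

Lemma append_exponent_max b (m : 'X_{1..d}) : append_exponent b m ord_max = b.
Proof. by rewrite mnmE unlift_none. Qed.

Lemma append_exponentK b : cancel (append_exponent b) drop_exponent.
Proof. by move=> m; apply/mnmP => i; rewrite !mnmE liftK. Qed.

Lemma drop_exponentK m : append_exponent (m ord_max) (drop_exponent m) = m.
Proof.
apply/mnmP => i; rewrite mnmE; case: unliftP => [j ->|->] //.
by rewrite mnmE.
Qed.

Lemma mdeg_append_exponent b (m : 'X_{1..d}) : mdeg (append_exponent b m) = mdeg m + b.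
Proof.
rewrite !mdegE big_ord_recr /= append_exponent_max; congr (_ + _).
apply: eq_bigr => i _; rewrite mnmE.
have -> : widen_ord (leqnSn d) i = lift ord_max i.
  by apply/val_inj; rewrite /= /bump leqNgt ltn_ord.
by rewrite liftK.
Qed.

(** The index [ord_max] is that of [y]. With [y]-exponent 1 the second condition says that the
    degree in the [x_i] plus [s] is less than [n]; the additive form avoids truncated subtraction
    and treats both exponents at once. *)
Definition standard (n s : nat) m : bool :=
  (m ord_max < 2) && (mdeg m + s * m ord_max < n + m ord_max).

Definition standard_monomials (n s : nat) : seq 'X_{1..d.+1} :=
  sort (fun m m' => mdeg m' <= mdeg m)
    (map (append_exponent 0) (simplex d n) ++
     map (append_exponent 1) (simplex d (n - s))).

Lemma mem_standard_monomials n s m :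
  (m \in standard_monomials n s) = standard n s m.
Proof.
have mem_append b n' : (m \in map (append_exponent b) (simplex d n')) =
    (m ord_max == b) && (mdeg m < n' + b).
  apply/mapP/andP => [[m' + ->] | [/eqP <-]].
    by rewrite mem_simplex append_exponent_max mdeg_append_exponent ltn_add2r.
  rewrite -{1}[m]drop_exponentK mdeg_append_exponent ltn_add2r => lt_mn.
  by exists (drop_exponent m); rewrite ?mem_simplex // drop_exponentK.
rewrite mem_sort mem_cat !mem_append /standard.
by move: (ord_max_le_mdeg m); case: (m ord_max) => [|[|b]] //=; lia.
Qed.

Lemma uniq_standard_monomials n s : uniq (standard_monomials n s).
Proof.
have inj b : injective (append_exponent b) := can_inj (@append_exponentK b).
rewrite sort_uniq cat_uniq !(map_inj_uniq (inj _)) !uniq_simplex andbT /=.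
apply/hasPn => _ /mapP[m _ ->]; apply/mapP => -[m' _].
by move/(congr1 (fun x : 'X_{1..d.+1} => x ord_max)); rewrite !append_exponent_max.
Qed.

Lemma size_standard_monomials n s : 0 < d ->
  size (standard_monomials n s) =
    'C((n + d).-1, d) + 'C((n - s + d).-1, d).
Proof.
by move=> d_gt0; rewrite size_sort size_cat !(size_map (append_exponent _)) !size_simplex.
Qed.

Lemma mdeg_standard_monomials n s i j :
  i <= j -> j < size (standard_monomials n s) ->
  mdeg (nth 0%MM (standard_monomials n s) j) <=
  mdeg (nth 0%MM (standard_monomials n s) i).
Proof.
move=> le_ij lt_j; pose r m m' := mdeg m' <= mdeg m.
apply: (@sorted_leq_nth _ r _ _ 0%MM (standard_monomials n s)) => //.
- by move=> m1 m2 m3 le12 le23; apply: leq_trans le23 le12.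
- by move=> m; apply: leqnn.
- by apply: sort_sorted => m m'; apply: leq_total.
- by rewrite inE (leq_ltn_trans le_ij).
Qed.

Lemma standard0 n s : 0 < n -> standard n s 0%MM.
Proof. by move=> n_gt0; rewrite /standard mdeg0 mnm0E muln0 !addn0. Qed.

Lemma standard_n0 s m : standard 0 s m = false.
Proof. by rewrite /standard; have := ord_max_le_mdeg m; lia. Qed.

Lemma mdeg_standard n s m : standard n s m -> mdeg m <= n.
Proof. by rewrite /standard => /andP[]; nia. Qed.

(** This makes [standard_ideal] stable under multiplication by the ring. If [y] divides [m1], the
    degree of [m1] is at least 1, which absorbs the extra 1 on the right of the bound. *)
Lemma standardD_r n s m1 m2 : standard n s (m1 + m2)%MM -> standard n s m2.
Proof.
rewrite /standard mdegD mnmDE => /andP[].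
have := ord_max_le_mdeg m1; have := ord_max_le_mdeg m2.
by case: (m1 _) (m2 _) => [|[|a]] [|[|b]] //=; lia.
Qed.

(** Contrapositive, on exponents, of the inclusion I_a I_b in I_(a+b). At most one factor contains
    [y]; if both bounds failed, the degrees would add up to a violation of the bound for the
    product, since the shift of that factor is at most [s]. *)
Lemma standardD n1 n2 s1 s2 s m1 m2 : s1 <= s -> s2 <= s ->
  standard (n1 + n2) s (m1 + m2)%MM -> standard n1 s1 m1 || standard n2 s2 m2.
Proof.
rewrite /standard mdegD mnmDE => le1 le2 /andP[].
by case: (m1 _) (m2 _) => [|[|a]] [|[|b]] //=; lia.
Qed.

End Standard.
End StandardMonomials.

(** * The ideals I_n and the coordinates on R / I_n *)

Module StandardIdeal.
Import mpoly StandardMonomials.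
Local Open Scope quotient_scope.

Lemma fps_coefM_eq0 n (k : comNzRingType) (p q : fps n k) m :
  (forall m1 m2, m = (m1 + m2)%MM -> p m1 = 0 \/ q m2 = 0) -> (p * q) m = 0.
Proof.
move=> eq0; rewrite fps_coefM; apply: big1 => h /eqP /eq0[] ->.
  by rewrite mul0r.
by rewrite mulr0.
Qed.

Lemma fps_coefCM n (k : comNzRingType) c (p : fps n k) m :
  (fps_const n c * p) m = c * p m.
Proof.
rewrite [LHS](@fps_mulE _ _ _ _ m c%:MP (fps_trunc (mdeg m).+1 p)).
- by rewrite mcoeffCM fps_truncE ltnS leqnn.
- by move=> m' _; rewrite mcoeffC mulr_natr.
- by move=> m' lm; rewrite fps_truncE ltnS lm.
Qed.

Section Coefficients.
Context (k : fieldType) (d : nat).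
Implicit Types (m : 'X_{1..d.+1}) (x y : nil_ring k d).

Lemma ideal_y2_coef (p : fps d.+1 k) m :
  p \in @ideal_y2 k d -> (m ord_max < 2)%N -> p m = 0.
Proof.
move=> /boolp.asboolP[b ->] lt_m2; apply: fps_coefM_eq0 => m1 m2 em; left.
rewrite expr2; apply: fps_coefM_eq0 => m3 m4 em1 /=.
case: (eqVneq m3 U_(ord_max)%MM) => [e3 | _]; last by left.
case: (eqVneq m4 U_(ord_max)%MM) => [e4 | _]; last by right.
by move: lt_m2; rewrite em em1 e3 e4 !mnmDE mnm1E eqxx.
Qed.

(* Well defined modulo y^2 only at the monomials of degree at most 1 in y. *)
Definition nil_coef m x : k := repr x m.

Lemma nil_coef_pi m (p : fps d.+1 k) : (m ord_max < 2)%N ->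
  nil_coef m (\pi_(nil_ring k d) p) = p m.
Proof.
move=> lt_m2; apply/eqP; rewrite -subr_eq0 -fps_coefN -fps_coefD; apply/eqP.
by apply: ideal_y2_coef lt_m2; rewrite -pi_nil_ringE reprK.
Qed.

Lemma nil_coefD m x y : (m ord_max < 2)%N ->
  nil_coef m (x + y) = nil_coef m x + nil_coef m y.
Proof.
by move=> lt_m2; rewrite -{1}[x]reprK -{1}[y]reprK -pi_nil_ringD nil_coef_pi.
Qed.

Lemma nil_coefM_eq0 m x y : (m ord_max < 2)%N ->
  (forall m1 m2, m = (m1 + m2)%MM -> nil_coef m1 x = 0 \/ nil_coef m2 y = 0) ->
  nil_coef m (x * y) = 0.
Proof.
move=> lt_m2 eq0; rewrite -[x]reprK -[y]reprK -pi_nil_ringM nil_coef_pi //.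
exact: fps_coefM_eq0.
Qed.

Definition nil_const (c : k) : nil_ring k d := \pi_(nil_ring k d) (fps_const d.+1 c).

Lemma nil_coefCM m c x : (m ord_max < 2)%N ->
  nil_coef m (nil_const c * x) = c * nil_coef m x.
Proof.
by move=> lt_m2; rewrite -{1}[x]reprK -pi_nil_ringM nil_coef_pi // fps_coefCM.
Qed.

Lemma nil_coef0 m : (m ord_max < 2)%N -> nil_coef m 0 = 0.
Proof. by move=> lt_m2; apply: (addrI (nil_coef m 0)); rewrite -nil_coefD ?addr0. Qed.

Lemma nil_coef1 m : (m ord_max < 2)%N -> nil_coef m 1 = (m == 0%MM)%:R.
Proof. by move=> lt_m2; rewrite -pi_nil_ring1 nil_coef_pi. Qed.

Lemma nil_coefX m x N : x \in max_ideal (nil_ring k d) ->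
  (m ord_max < 2)%N -> (mdeg m < N)%N -> nil_coef m (x ^+ N) = 0.
Proof.
move=> nonunit lt_m2 lt_mN.
have -> : x ^+ N = \pi_(nil_ring k d) (repr x ^+ N).
  elim: {lt_mN} N => [|N IH]; first by rewrite !expr0 pi_nil_ring1.
  by rewrite !exprS pi_nil_ringM -IH reprK.
rewrite nil_coef_pi // fps_coefX //; apply/eqP.
by rewrite -nil_ring_nonunitE reprK.
Qed.

(** The ideal m^n + m^(n - s) y, given by vanishing coefficients instead of generators. Only
    coefficients independent of the representative modulo y^2 are tested. *)
Definition standard_ideal (n s : nat) : {pred (nil_ring k d)^o} :=
  [pred x : nil_ring k d |
    boolp.asbool (forall m, standard n s m -> nil_coef m x = 0)].

Lemma standard_idealP n s x :
  reflect (forall m, standard n s m -> nil_coef m x = 0) (x \in standard_ideal n s).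
Proof. exact: boolp.asboolP. Qed.

Lemma standard_lt2 n s m : standard n s m -> (m ord_max < 2)%N.
Proof. by case/andP. Qed.

Lemma nil_coef_scale_eq0 n s m x y : standard n s m ->
  (forall m1 m2, m = (m1 + m2)%MM -> standard n s m2 -> nil_coef m2 y = 0) ->
  nil_coef m (x * y) = 0.
Proof.
move=> std_m eq0; apply: nil_coefM_eq0 => [|m1 m2 em]; first exact: standard_lt2 std_m.
by right; apply: (eq0 m1) => //; apply: (@standardD_r _ _ _ m1); rewrite -em.
Qed.

Lemma standard_ideal_closed n s : GRing.submod_closed (standard_ideal n s).
Proof.
split=> [|a x y /standard_idealP x0 /standard_idealP y0]; apply/standard_idealP => m std_m.
  exact: nil_coef0 (standard_lt2 std_m).
rewrite nil_coefD ?(standard_lt2 std_m) // y0 // addr0.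
by apply: nil_coef_scale_eq0 (std_m) _ => m1 m2 _; apply: x0.
Qed.

HB.instance Definition _ n s :=
  GRing.isSubmodClosed.Build (nil_ring k d) (nil_ring k d)^o
    (standard_ideal n s) (GRing.submod_closed_semi (@standard_ideal_closed n s)).

Definition standard_family (s : nat -> nat) (n : nat) : ideal (nil_ring k d) :=
  standard_ideal n (s n).

Lemma standard_family_graded (s : nat -> nat) :
  {homo s : m n / (m <= n)%N} -> graded_family (standard_family s).
Proof.
move=> s_mono; split=> [x | a b z].
  by rewrite inE; apply/standard_idealP => m; rewrite standard_n0.
move=> /boolp.asboolP[t [memt ->]]; rewrite big_seq.
apply: (@rpred_sum _ (standard_family s (a + b))) => p /memt[].
move=> /standard_idealP p1 /standard_idealP p2; apply/standard_idealP => m std_m.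
apply: nil_coefM_eq0 => [|m1 m2 em]; first exact: standard_lt2 std_m.
rewrite em in std_m.
have le1 : (s a <= s (a + b))%N by rewrite s_mono ?leq_addr.
have le2 : (s b <= s (a + b))%N by rewrite s_mono ?leq_addl.
by case/orP: (standardD le1 le2 std_m) => [/p1|/p2]; [left | right].
Qed.

(** A proper ideal containing a power of every nonunit is primary to the maximal ideal: if [x * y]
    is in it, either [y] is a nonunit and has a power in it, or [y] is invertible and [x] is in
    it. *)
Lemma standard_ideal_primary n s : (0 < n)%N ->
  max_primary (standard_ideal n s : ideal (nil_ring k d)).
Proof.
move=> n_gt0.
have not1 : (1 : nil_ring k d) \notin standard_ideal n s.
  apply/standard_idealP => /(_ 0%MM (standard0 d s n_gt0)) /eqP.
  by rewrite nil_coef1 ?mnm0E // eqxx oner_eq0.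
(* The exponent is [n.+1] because a standard monomial divisible by [y] has degree [n] in the extreme
   case [s = 0]. *)
have nilp x : x \in max_ideal (nil_ring k d) -> x ^+ n.+1 \in standard_ideal n s.
  move=> x_max; apply/standard_idealP => m std_m.
  by rewrite nil_coefX ?(standard_lt2 std_m) // ltnS (mdeg_standard std_m).
have memZ a x : x \in standard_ideal n s -> a * x \in standard_ideal n s.
  by move=> Ix; apply: (@rpredZ _ _ (standard_ideal n s) a _ Ix).
split; first split=> // x y Ixy.
  have [y_max | /boolp.asboolPn/boolp.contrapT[z yz1]] :=
    boolP (y \in max_ideal (nil_ring k d)).
    by right; exists n.+1; apply: nilp.
  by left; rewrite -[x]mulr1 -yz1 mulrA mulrC memZ.
move=> x; apply/boolp.asboolP/idP => [[N IxN] | /nilp]; last by exists n.+1.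
apply/boolp.asboolP => -[y xy1]; case/negP: not1.
by rewrite -(expr1n _ N) -xy1 exprMn mulrC memZ.
Qed.

Definition standard_coords n s x : 'rV[k]_(size (standard_monomials d n s)) :=
  \row_j nil_coef (nth 0%MM (standard_monomials d n s) j) x.

Lemma standard_nth n s (j : 'I_(size (standard_monomials d n s))) :
  standard n s (nth 0%MM (standard_monomials d n s) j).
Proof. by rewrite -mem_standard_monomials mem_nth. Qed.

Lemma standard_coordsD n s : {morph standard_coords n s : x y / x + y}.
Proof.
by move=> x y; apply/rowP => j; rewrite !mxE nil_coefD ?(standard_lt2 (standard_nth j)).
Qed.

Lemma standard_coordsCM n s c x :
  standard_coords n s (nil_const c * x) = c *: standard_coords n s x.
Proof.
by apply/rowP => j; rewrite !mxE nil_coefCM ?(standard_lt2 (standard_nth j)).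
Qed.

Lemma standard_coords_eq0 n s x :
  standard_coords n s x = 0 <-> x \in standard_ideal n s.
Proof.
split=> [/rowP x0 | /standard_idealP x0]; last first.
  by apply/rowP => j; rewrite !mxE x0 // standard_nth.
apply/standard_idealP => m; rewrite -mem_standard_monomials => m_std.
have lt_m : (index m (standard_monomials d n s) < size (standard_monomials d n s))%N.
  by rewrite index_mem.
by have := x0 (Ordinal lt_m); rewrite !mxE /= nth_index.
Qed.

Lemma standard_coords_delta n s j : exists x, standard_coords n s x = delta_mx 0 j.
Proof.
pose m0 := nth 0%MM (standard_monomials d n s) j.
exists (\pi_(nil_ring k d) (Fps (fun m => (m == m0)%:R))); apply/rowP => i.
rewrite !mxE nil_coef_pi ?(standard_lt2 (standard_nth i)) //=.
by rewrite nth_uniq ?uniq_standard_monomials.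
Qed.

(* The standard monomials are listed by decreasing degree, and a coefficient of
   a * x only involves coefficients of x at divisors. *)
Lemma standard_coords_triangular n s a x (j : 'I_(size (standard_monomials d n s))) :
  (forall i : 'I_(size (standard_monomials d n s)), (j <= i)%N ->
     standard_coords n s x 0 i = 0) -> standard_coords n s (a * x) 0 j = 0.
Proof.
move=> x0; rewrite mxE; apply: nil_coef_scale_eq0 (standard_nth j) _ => m1 m2 em std_m2.
set S := standard_monomials d n s in j x0 em *.
have m2S : m2 \in S by rewrite mem_standard_monomials.
have lt_m2 : (index m2 S < size S)%N by rewrite index_mem.
have := x0 (Ordinal lt_m2); rewrite mxE /= nth_index //; apply.
rewrite leqNgt; apply/negP => lt_ij.
have := mdeg_standard_monomials (ltnW lt_ij) (ltn_ord j).
rewrite nth_index // em mdegD -[X in (_ <= X)%N]add0n leq_add2r leqn0 mdeg_eq0.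
move=> /eqP m1_0; move: lt_ij.
rewrite -{1}(index_uniq 0%MM (ltn_ord j)) ?uniq_standard_monomials //.
by rewrite em m1_0 add0m ltnn.
Qed.

End Coefficients.
End StandardIdeal.

From mathcomp Require Import boolp classical_sets reals ereal.
From mathcomp Require Import topology normedtype sequences.

Import Order.TTheory Num.Theory numFieldNormedType.Exports.
Import StandardMonomials StandardIdeal.

(** * Length of a module with triangular coordinates over a field *)

Section Length.
Context (R : realType) (k : fieldType) (A : comNzRingType) (M : lmodType A).
Context (N : nat) (phi : M -> 'rV[k]_N) (const : k -> A).
Hypothesis phiD : {morph phi : x y / x + y}.
Hypothesis phiZ : forall c x, phi (const c *: x) = c *: phi x.
Hypothesis phi_inj : injective phi.

Let phi0 : phi 0 = 0.
Proof. by apply: (addrI (phi 0)); rewrite -phiD !addr0. Qed.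

(** Vectors chosen in each [c i.+1] outside [c i] have linearly independent coordinates: in a
    nontrivial relation, the last vector with nonzero coefficient would lie in the submodule that it
    was chosen to avoid. *)
Lemma chain_leq_coordinates n (c : nat -> {pred M}) : submod_chain n c -> (n <= N)%N.
Proof.
move=> [c_sub c_lt].
have c_mono i j : (i <= j <= n)%N -> {subset c i <= c j}.
  elim: j => [|j IH]; first by rewrite leqn0 => /andP[/eqP -> _].
  rewrite leq_eqVlt => /andP[/predU1P[-> _ x|] // lt_ij lt_jn x cx].
  have [sub _] := c_lt j lt_jn; apply/sub/IH => //.
  by rewrite -ltnS lt_ij ltnW.
have /choice[v vP] (i : 'I_n) : exists x, x \in c i.+1 /\ x \notin c i.
  have [_ /existsNP[x]] := c_lt i (ltn_ord i).
  by move=> /not_implyP[? /negP ?]; exists x.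
pose V : 'M[k]_(n, N) := \matrix_i phi (v i).
suff /eqP <- : row_free V by apply: rank_leq_col.
apply: inj_row_free => w wV0; apply/rowP => i0; rewrite mxE; apply/eqP.
apply/negP => /negP wi0.
have [i wi wmax] :=
  @arg_maxnP _ i0 (fun i => w 0 i != 0) (fun i => nat_of_ord i) wi0.
have sum0 : \sum_j const (w 0 j) *: v j = 0.
  apply: phi_inj; rewrite (big_morph phi phiD phi0) phi0 -[RHS]wV0 mulmx_sum_row.
  by apply: eq_bigr => j _; rewrite phiZ rowK.
have [c0 cD] := c_sub i (ltnW (ltn_ord i)).
(* Injectivity of [phi] transfers the laws of scalar multiplication from row vectors to [const]. *)
have const_v a b (x : M) : const a *: (const b *: x) = const (a * b) *: x.
  by apply: phi_inj; rewrite !phiZ scalerA.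
have const1 (x : M) : const 1 *: x = x by apply: phi_inj; rewrite phiZ scale1r.
have cZ a (x : M) : x \in c i -> a *: x \in c i.
  by move=> cx; rewrite -[_ *: _]addr0 cD.
have cAdd (x y : M) : x \in c i -> y \in c i -> x + y \in c i.
  by move=> cx cy; rewrite -[x]scale1r cD.
(* Solve the relation for [v i]: terms of index above [i] vanish, and those of index below [i] lie
   in [c i]. *)
case/negP: (vP i).2; rewrite -[v i]const1 -(mulVf wi) -const_v cZ //.
move: sum0; rewrite (bigD1 i) //= => /eqP; rewrite addr_eq0 => /eqP ->.
rewrite -scaleN1r cZ //; elim/big_ind: _ => // j ne_ji.
have [wj0 | wj0] := eqVneq (w 0 j) 0.
  suff -> : const (w 0 j) *: v j = 0 by [].
  by apply: phi_inj; rewrite phiZ wj0 scale0r phi0.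
apply/cZ/(c_mono j.+1); last exact: (vP j).1.
by rewrite (ltnW (ltn_ord i)) andbT ltn_neqAle ne_ji; apply: wmax.
Qed.

Hypothesis phi_delta : forall j, exists x, phi x = delta_mx 0 j.
Hypothesis phi_triangular : forall a x (j : 'I_N),
  (forall i : 'I_N, (j <= i)%N -> phi x 0 i = 0) -> phi (a *: x) 0 j = 0.

(* The flag of submodules on which the coordinates of index at least i vanish
   is a composition series. *)
Lemma module_length_coordinates : module_length R M = N%:R%:E.
Proof.
apply/eqP; rewrite eq_le; apply/andP; split.
  apply: ge_ereal_sup => _ [n [c c_chain] <-].
  by rewrite lee_fin ler_nat (chain_leq_coordinates c_chain).
apply: ereal_sup_ubound; exists N => //.
pose c i : {pred M} := [pred x | [forall j : 'I_N, (i <= j)%N ==> (phi x 0 j == 0)]].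
have cP i x : reflect (forall j : 'I_N, (i <= j)%N -> phi x 0 j = 0) (x \in c i).
  apply: (iffP forallP) => [h j le_ij | h j].
    by apply/eqP; apply: (implyP (h j)).
  by apply/implyP => /h ->.
exists c; split=> i le_i.
  split=> [|a x y /cP x0 /cP y0]; apply/cP => j le_ij; first by rewrite phi0 mxE.
  rewrite phiD mxE y0 // addr0; apply: phi_triangular => j' le_jj'.
  by rewrite x0 // (leq_trans le_ij).
split=> [x /cP x0 | sub]; first by apply/cP => j /ltnW; apply: x0.
have [x phix] := phi_delta (Ordinal le_i).
have /sub/cP/(_ (Ordinal le_i) (leqnn _)) : x \in c i.+1.
  by apply/cP => j lt_ij; rewrite phix mxE eqxx -val_eqE /= gtn_eqF.
by rewrite phix mxE !eqxx => /eqP; rewrite oner_eq0.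
Qed.

End Length.

(** * The length of R / I_n *)

Local Open Scope quotient_scope.

(** The kernel of the coordinates is the ideal. Hence the coordinates of a representative depend
    only on its class, and they are injective on classes. *)
Lemma module_length_standard (R : realType) (k : fieldType) (d n s : nat) :
  (0 < d)%N ->
  module_length R (quot_module (standard_ideal n s : ideal (nil_ring k d))) =
  ('C((n + d).-1, d) + 'C((n - s + d).-1, d))%:R%:E.
Proof.
move=> d_gt0; set I : ideal _ := standard_ideal n s.
rewrite -size_standard_monomials //.
pose phi (x : quot_module I) := standard_coords n s (repr x : nil_ring k d).
have coordsB (u v : nil_ring k d) : standard_coords n s (u - v) =
    standard_coords n s u - standard_coords n s v.
  by apply/eqP; rewrite eq_sym subr_eq -standard_coordsD subrK.
have phi_pi u : phi (\pi_(quot_module I) u) = standard_coords n s u.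
  apply/eqP; rewrite -subr_eq0 -coordsB; apply/eqP/standard_coords_eq0.
  by rewrite -[_ \in _]pi_quot_moduleE reprK.
apply: (@module_length_coordinates R k _ _ _ phi (@nil_const k d)).
- move=> x y; rewrite -{1}[x]reprK -{1}[y]reprK -pi_quot_moduleD phi_pi.
  exact: standard_coordsD.
- move=> c x; rewrite -{1}[x]reprK -[_ *: _]pi_quot_scale phi_pi.
  exact: standard_coordsCM.
- move=> x y /eqP; rewrite -subr_eq0 -coordsB => /eqP/standard_coords_eq0.
  by rewrite -[_ \in _]pi_quot_moduleE !reprK => /eqP.
- by move=> j; have [x <-] := standard_coords_delta k j; exists (\pi x).
- move=> a x j x0; rewrite -[x]reprK -[_ *: _]pi_quot_scale phi_pi.
  exact: standard_coords_triangular.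
Qed.

(** * Asymptotics of the binomial coefficients *)

Local Open Scope classical_set_scope.

(** The falling factorial from n + d - 1, read backwards. *)
Lemma bin_rising_prod n d : ('C((n + d).-1, d) * d`! = \prod_(i < d) (n + i))%N.
Proof.
rewrite bin_ffact ffact_prod (reindex_inj rev_ord_inj) /=.
by apply: eq_bigr => i _; have := ltn_ord i; lia.
Qed.

Lemma expn_leq_bin_rising n d : (n ^ d <= 'C((n + d).-1, d) * d`!)%N.
Proof.
rewrite bin_rising_prod -[X in (_ ^ X)%N]card_ord -prod_nat_const.
by apply: leq_prod => i _; apply: leq_addr.
Qed.

Section Density.
Context (R : realType) (d : nat).

(** For d > 0 this is the length of S / m^n divided by n^d, where S = k[[x_1, ..., x_d]]. *)
Definition simplex_density (n : nat) : R := 'C((n + d).-1, d)%:R / n%:R ^+ d.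

Lemma simplex_densityE n : (0 < n)%N ->
  simplex_density n = (\prod_(i < d) (1 + i%:R / n%:R)) / d`!%:R.
Proof.
move=> n_gt0; have n0 : n%:R != 0 :> R by rewrite pnatr_eq0 -lt0n.
have f0 : d`!%:R != 0 :> R by rewrite pnatr_eq0 -lt0n fact_gt0.
have nd0 : n%:R ^+ d != 0 :> R by rewrite expf_eq0 (negPf n0) andbF.
apply: (canRL (mulfK f0)); rewrite /simplex_density mulrAC -natrM bin_rising_prod.
rewrite natr_prod; apply: (canLR (mulfK nd0)).
rewrite -[X in _ ^+ X]card_ord -prodr_const -big_split /=.
by apply: eq_bigr => i _; rewrite mulrDl mul1r divfK // natrD.
Qed.

Lemma invn_cvg0 : (n%:R^-1 : R) @[n --> \oo] --> (0 : R).
Proof.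
apply/gtr0_cvgV0; last exact: cvgr_idn.
by near=> n; rewrite ltr0n; near: n; exists 1%N.
Unshelve. all: by end_near. Qed.

(** By [simplex_densityE] the number of factors 1 + i/n is fixed, and each of them tends to 1. *)
Lemma simplex_density_cvg : simplex_density n @[n --> \oo] --> (d`!%:R^-1 : R).
Proof.
have cst_cvg (x : R) : (fun _ : nat => x) @ \oo --> x by apply: cvg_cst.
have prod_cvg e : \prod_(i < e) (1 + i%:R / n%:R : R) @[n --> \oo] --> (1 : R).
  elim: e => [|e IH].
    by under eq_fun do rewrite big_ord0; apply: cst_cvg.
  under eq_fun do rewrite big_ord_recr /=.
  have := cvgM IH (cvgD (cst_cvg 1) (cvgM (cst_cvg e%:R) (@invn_cvg0))).
  by rewrite mulr0 addr0 mulr1; apply.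
have lim : (\prod_(i < d) (1 + i%:R / n%:R : R)) / d`!%:R @[n --> \oo]
    --> (d`!%:R^-1 : R).
  by have := cvgM (prod_cvg d) (cst_cvg d`!%:R^-1); rewrite mul1r; apply.
apply: cvg_trans lim; apply: near_eq_cvg; near=> n.
rewrite /= simplex_densityE //; near: n; exists 1%N => //.
Unshelve. all: by end_near. Qed.

(** The binomial coefficient is at least m^d / d!, and m is at least n / q. Applied with [q = 4] to
    the [y]-part of the length and with [q = 1] to the other part. *)
Lemma invf_leq_bin_rising m n q : (0 < n)%N -> (n <= q * m)%N ->
  (q ^ d * d`!)%:R^-1 <= 'C((m + d).-1, d)%:R / n%:R ^+ d :> R.
Proof.
move=> n_gt0 le_nm; have q_gt0 : (0 < q)%N by case: q le_nm => //; lia.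
rewrite ler_pdivlMr -?natrX ?ltr0n ?expn_gt0 ?n_gt0 //.
rewrite ler_pdivrMl ?ltr0n ?muln_gt0 ?expn_gt0 ?q_gt0 ?fact_gt0 //.
rewrite -natrM ler_nat.
have : (n ^ d <= (q * m) ^ d)%N by case: (d) => // e; rewrite leq_exp2r.
rewrite expnMn => /leq_trans; apply; rewrite -mulnA leq_mul2l mulnC.
by rewrite expn_leq_bin_rising orbT.
Qed.

End Density.

(** * Powers of 2 near the terms of a progression, and comparison of limits *)

Definition floor_pow2 (n : nat) : nat := (2 ^ trunc_log 2 n)%N.

(** Since [trunc_log 2 0 = 0], the value at 0 is 1. This is harmless, as I_0 = R whatever the shift
    ([standard_n0]). *)
Lemma floor_pow2_mono : {homo floor_pow2 : m n / (m <= n)%N}.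
Proof. by move=> m n le_mn; rewrite leq_exp2l // leq_trunc_log. Qed.

Lemma floor_pow2_eq j n : (2 ^ j <= n < 2 ^ j.+1)%N -> floor_pow2 n = (2 ^ j)%N.
Proof. by move=> /trunc_log_eq e; rewrite /floor_pow2 e. Qed.

Lemma progression_after_pow2 a r N : (0 < r)%N ->
  exists2 b, (N <= b)%N & (a + b * r - floor_pow2 (a + b * r) < r)%N.
Proof.
(* As [j < 2 ^ j], this choice gives [N <= b] and puts the window of length [r] after [2 ^ j] below
   [2 ^ j.+1]. *)
move=> r_gt0; pose j := (a + N * r + r)%N.
have lt_j : (j < 2 ^ j)%N by apply: ltn_expl.
(* Division rounded up: [a + b * r] is the first term that is at least [2 ^ j]. *)
pose b := ((2 ^ j - a + r.-1) %/ r)%N.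
have eb := divn_eq (2 ^ j - a + r.-1) r; rewrite -/b in eb.
have lt_mod := ltn_pmod (2 ^ j - a + r.-1) r_gt0.
exists b; first by rewrite /b leq_divRL //; move: lt_j; rewrite /j; lia.
have nP : (2 ^ j <= a + b * r < 2 ^ j + r)%N.
  by move: lt_j eb lt_mod; rewrite /j; lia.
rewrite (@floor_pow2_eq j); first by lia.
by move: nP lt_j; rewrite expnS /j; lia.
Qed.

(** Take the last term n below 2^(j+1), with j so large that 2r < 2^j. Then n - 2^j >= 2^j - r >
    2^(j-1) > n/4, whence the factor 4. *)
Lemma progression_before_pow2 a r N : (0 < r)%N ->
  exists2 b, (N <= b)%N &
    (0 < a + b * r)%N /\ (a + b * r <= 4 * (a + b * r - floor_pow2 (a + b * r)))%N.
Proof.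
move=> r_gt0; pose j := (a + N * r + r + r)%N.
have lt_j : (j < 2 ^ j)%N by apply: ltn_expl.
pose b := ((2 ^ j.+1 - a - 1) %/ r)%N.
have eb := divn_eq (2 ^ j.+1 - a - 1) r; rewrite -/b in eb.
have lt_mod := ltn_pmod (2 ^ j.+1 - a - 1) r_gt0.
have e2 := expnS 2 j.
exists b; first by rewrite /b leq_divRL //; move: lt_j e2; rewrite /j; lia.
have nP : (2 ^ j.+1 - r <= a + b * r < 2 ^ j.+1)%N.
  by move: lt_j eb lt_mod e2; rewrite /j; lia.
rewrite (@floor_pow2_eq j); by move: nP lt_j e2; rewrite /j; lia.
Qed.

(** Choosing for each [N] an index beyond [N] where the inequality holds gives a map [g] tending to
    infinity; both limits persist along it. *)
Lemma frequently_cvg_le (R : realFieldType) (v w : nat -> \bar R) (l y : \bar R) :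
  v @ \oo --> l -> w @ \oo --> y ->
  (forall N, exists2 b, (N <= b)%N & (v b <= w b)%E) -> (l <= y)%E.
Proof.
move=> v_l w_y freq.
have /choice[g gP] N : exists b, (N <= b)%N /\ (v b <= w b)%E.
  by have [b ? ?] := freq N; exists b.
have g_oo : g @ \oo --> \oo.
  by apply/cvgnyPge => B; exists B => // n /= le_Bn; apply: leq_trans (gP n).1.
apply: (lee_cvg_to (cvg_comp _ _ g_oo v_l) (cvg_comp _ _ g_oo w_y)).
by apply: nearW => n; have [] := gP n.
Qed.

(** * Divergence along every arithmetic progression *)

Theorem mainTheorem5 (R : realType) (k : fieldType) (d : nat) (d_gt0 : (0 < d)%N) :
  exists I : nat -> ideal (nil_ring k d),
    graded_family I /\
    (forall n, (0 < n)%N -> max_primary (I n)) /\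
    let u (n : nat) : \bar R :=
      (module_length R (quot_module (I n)) * ((n%:R ^+ d)^-1)%:E)%E in
    ~ cvgn u /\
    forall a r : nat, (0 < r)%N -> ~ cvgn (fun b => u (a + b * r)%N).
Proof.
exists (standard_family k d floor_pow2).
split; first exact/standard_family_graded/floor_pow2_mono.
split=> [n n_gt0 | u]; first exact: standard_ideal_primary.
have uE n : u n = (simplex_density R d n +
    'C((n - floor_pow2 n + d).-1, d)%:R / n%:R ^+ d)%:E.
  by rewrite /u module_length_standard // -EFinM natrD mulrDl.
suff div a r : (0 < r)%N -> ~ cvgn (fun b => u (a + b * r)%N).
  (* The full sequence is the progression with [a = 0] and [r = 1]. *)
  split=> //; have <- : (fun b => u (0 + b * 1)%N) = u; last exact: div.
  by apply/funext => b; rewrite add0n muln1.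
(* The limit [l] is an extended real, so infinite limits are refuted as well. *)
move=> r_gt0 /cvg_ex[l u_l].
have f_gt0 : (0 < d`!)%N := fact_gt0 d.
pose K : R := 'C((r + d).-1, d)%:R.
(* Majorant of [u] at the terms just after a power of 2, where [K] bounds the second binomial
   coefficient; 1/n^d is at most 1/n because d > 0. *)
pose w n : \bar R := (simplex_density R d n + K / n%:R)%:E.
have idx_oo : (fun b => a + b * r)%N @ \oo --> \oo.
  apply/cvgnyPge => B; exists B => // n /= le_Bn; rewrite (leq_trans le_Bn) //.
  by rewrite (leq_trans _ (leq_addl _ _)) // leq_pmulr.
have w_lim : w @ \oo --> (d`!%:R^-1)%:E.
  apply: cvg_EFin; first by apply: nearW.
  have K_cvg : (fun _ : nat => K) @ \oo --> K by apply: cvg_cst.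
  have := cvgD (@simplex_density_cvg R d) (cvgM K_cvg (@invn_cvg0 R)).
  by rewrite mulr0 addr0; apply.
have le_l : (l <= (d`!%:R^-1)%:E)%E.
  apply: (frequently_cvg_le u_l (cvg_comp _ _ idx_oo w_lim)) => N.
  (* The maximum with 1 forces [b > 0], so that the term [a + b * r] is positive and can be
     inverted. *)
  have [b le_b lt_r] := progression_after_pow2 a (maxn N 1) r_gt0.
  exists b; first by rewrite (leq_trans _ le_b) // leq_maxl.
  have n_gt0 : (0 < a + b * r)%N by move: le_b; nia.
  rewrite /= uE lee_fin lerD2l; set n := (a + b * r)%N in n_gt0 lt_r *.
  apply: ler_pM; rewrite ?invr_ge0 ?exprn_ge0 ?ler0n //.
    by rewrite ler_nat leq_bin2l // -ltnS !prednK; lia.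
  rewrite lef_pV2 ?posrE ?exprn_gt0 ?ltr0n // -natrX ler_nat.
  by rewrite -[X in (X <= _)%N]expn1 leq_pexp2l.
(* The first density is at least 1/d! at every positive index, so a constant minorant suffices at
   the terms just before a power of 2. *)
have ge_l : ((d`!%:R^-1 + (4 ^ d * d`!)%:R^-1)%:E <= l)%E.
  pose y : \bar R := (d`!%:R^-1 + (4 ^ d * d`!)%:R^-1)%:E.
  have y_cst : (fun _ : nat => y) @ \oo --> y by apply: cvg_cst.
  apply: (frequently_cvg_le y_cst u_l) => N.
  have [b le_b [n_gt0 le4]] := progression_before_pow2 a N r_gt0.
  exists b => //; rewrite uE lee_fin lerD ?invf_leq_bin_rising //.
  have := @invf_leq_bin_rising R d _ _ 1 n_gt0 (eq_leq (esym (mul1n _))).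
  by rewrite exp1n mul1n.
have := le_trans ge_l le_l; rewrite lee_fin gerDl invr_le0 lern0 muln_eq0.
by rewrite expn_eq0 /= -leqn0 leqNgt f_gt0.
Qed.
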